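(* Let $\mathcal{O}$ be an $\mathcal{SH}$ ontology. Then $\mathcal{O}$ is set-theoretically consistent if and only if there is a clash-free tableau for $\mathcal{O}$.
   Context: $\mathcal{SH}$ syntax: concepts $\top,\bot,A,C\sqcap D,C\sqcup D,\neg C,\exists R.C,\forall R.C$ ($A$ concept name, $R$ role name); an ontology is a finite set of GCIs $C\sqsubseteq D$, role inclusions $R\sqsubseteq S$, transitivity axioms $S\circ S\sqsubseteq S$, concept assertions $\{a\}\sqsubseteq C$ and role assertions $\{(a,b)\}\sqsubseteq R$, with the standard Tarskian set semantics; $\mathcal O$ is set-theoretically consistent iff it has a model. $\mathsf{NNF}$ denotes negation normal form (negation only before concept names); tableau labels contain concepts in NNF. Write $R\sqsubseteq^* S$ if $R=S$ or there is a chain $R=R_0,\dots,R_k=S$ with each $R_i\sqsubseteq R_{i+1}\in\mathcal O$; call $S$ transitive if $S\circ S\sqsubseteq S\in\mathcal O$. A tableau $T=\langle\mathcal V,\mathcal E,\mathcal L\rangle$ (nodes, edges, labelling of nodes by sets of concepts) for $\mathcal O$ is obtained by applying the following rules until none is applicable (the only nondeterministic choice is in the $\sqcup$-rule): Init: for each individual $a$ a node $x^a$ with $\{a\}\in\mathcal L(x^a)$ and $C\in\mathcal L(x^a)$ for each $\{a\}\sqsubseteq C\in\mathcal O$; for each $\{(a,b)\}\sqsubseteq R\in\mathcal O$ an edge $(x^a,x^b)$, and $x^b$ is an $S$-successor of $x^a$ for every $S$ with $R\sqsubseteq^* S$. $\sqsubseteq$-rule: for each GCI $E\sqsubseteq F\in\mathcal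 O$ add $\mathsf{NNF}(\neg E\sqcup F)$ to $\mathcal L(x)$ for all nodes $x$. $\sqcap$-rule: if $D_1\sqcap D_2\in\mathcal L(x)$ and $\{D_1,D_2\}\not\subseteq\mathcal L(x)$, add $D_1,D_2$. $\sqcup$-rule: if $D_1\sqcup D_2\in\mathcal L(x)$ and $\{D_1,D_2\}\cap\mathcal L(x)=\emptyset$, add one of $D_1,D_2$. $\exists$-rule: if $\exists R.D\in\mathcal L(x)$, $x$ has no $R$-successor $y$ with $D\in\mathcal L(y)$, and $x$ is not blocked (i.e. $x$ has no ancestor $x'$ with $\mathcal L(x)\subseteq\mathcal L(x')$), add a new node $y$, edge $(x,y)$, $D\in\mathcal L(y)$; $y$ is an $S$-successor of $x$ for every $S$ with $R\sqsubseteq^* S$. $\forall$-rule: if $\forall R.D\in\mathcal L(x)$ and $y$ is an $R$-successor of $x$, add $D$ to $\mathcal L(y)$. $\forall_\exists$-rule: if $\{\exists P.C,\forall R.D\}\subseteq\mathcal L(x)$, $D$ is not a conjunct of $C$, $y$ is a $P$-successor of $x$, $\{C,D\}\subseteq\mathcal L(y)$, $P\sqsubseteq^* R$ and $\exists P.(C\sqcap D)\notin\mathcal L(x)$, add $\exists P.(C\sqcap D)$ to $\mathcal L(x)$ and $C\sqcap D$ to $\mathcal L(y)$; moreover if $\{(a,b)\}\sqsubseteq P\in\mathcal O$, $\forall R.D\in\mathcal L(x^a)$, $P\sqsubseteq^* R$, $D\in\mathcal L(x^b)$ and $\exists P.D\notin\mathcal L(x^a)$, add $\exists P.D$ to $\mathcal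 L(x^a)$. $\forall^+$-rule: if $\forall R.D\in\mathcal L(x)$, $S$ transitive, $S\sqsubseteq^* R$, $y$ an $S$-successor of $x$ and $\forall S.D\notin\mathcal L(y)$, add $\forall S.D$ to $\mathcal L(y)$. $\forall^+_\exists$-rule: if $\{\exists P.C,\forall R.D\}\subseteq\mathcal L(x)$, $S$ transitive, $S\sqsubseteq^* R$, $P\sqsubseteq^* S$, $\forall S.D$ not a conjunct of $C$, $y$ a $P$-successor of $x$, $\{C,\forall S.D\}\subseteq\mathcal L(y)$ and $\exists P.(C\sqcap\forall S.D)\notin\mathcal L(x)$, add $\exists P.(C\sqcap\forall S.D)$ to $\mathcal L(x)$ and $C\sqcap\forall S.D$ to $\mathcal L(y)$; moreover if $\{(a,b)\}\sqsubseteq P\in\mathcal O$, $\forall R.D\in\mathcal L(x^a)$, $\forall S.D\in\mathcal L(x^b)$, $S$ transitive, $S\sqsubseteq^* R$, $P\sqsubseteq^* S$ and $\exists P.\forall S.D\notin\mathcal L(x^a)$, add $\exists P.\forall S.D$ to $\mathcal L(x^a)$ (and $\forall S.D$ to $\mathcal L(x^b)$). A tableau has a clash if $\{A,\neg A\}\subseteq\mathcal L(x)$ for some node $x$ and concept name $A$; otherwise it is clash-free.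
   Formalization: An occurrence of ⊥ in a label also counts as a clash (otherwise {a} ⊑ ⊥ is a counterexample); the set of individuals is finite and nonempty, so that Init creates at least one node; and a node is not counted as its own ancestor when role assertions form cycles. *)

(* Defs.v *)
From HB Require Import structures.
From Stdlib Require Import Relation_Operators.
From mathcomp Require Import all_boot finmap.

Set Implicit Arguments.
Unset Strict Implicit.
Unset Printing Implicit Defensive.

Local Open Scope fset_scope.

(** * Syntax *)

Inductive concept (NC NR : Type) : Type :=
| Top
| Bot
| Atom of NC
| And of concept NC NR & concept NC NR
| Or of concept NC NR & concept NC NR
| Not of concept NC NR
| Ex of NR & concept NC NR
| All of NR & concept NC NR.

Arguments Top {NC NR}.
Arguments Bot {NC NR}.
Arguments Atom {NC NR} _.
Arguments And {NC NR} _ _.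
Arguments Or {NC NR} _ _.
Arguments Not {NC NR} _.
Arguments Ex {NC NR} _ _.
Arguments All {NC NR} _ _.

Section ConceptEncoding.
Variables NC NR : Type.

Fixpoint encode_concept (C : concept NC NR) : GenTree.tree (NC + NR) :=
  match C with
  | Top => GenTree.Node 0 [::]
  | Bot => GenTree.Node 1 [::]
  | Atom A => GenTree.Leaf (inl A)
  | And C D => GenTree.Node 2 [:: encode_concept C; encode_concept D]
  | Or C D => GenTree.Node 3 [:: encode_concept C; encode_concept D]
  | Not C => GenTree.Node 4 [:: encode_concept C]
  | Ex R C => GenTree.Node 5 [:: GenTree.Leaf (inr R); encode_concept C]
  | All R C => GenTree.Node 6 [:: GenTree.Leaf (inr R); encode_concept C]
  end.

Fixpoint decode_concept (t : GenTree.tree (NC + NR)) : option (concept NC NR) :=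
  match t with
  | GenTree.Node 0 [::] => Some Top
  | GenTree.Node 1 [::] => Some Bot
  | GenTree.Leaf (inl A) => Some (Atom A)
  | GenTree.Node 2 [:: c; d] =>
      if (decode_concept c, decode_concept d) is (Some C, Some D)
      then Some (And C D) else None
  | GenTree.Node 3 [:: c; d] =>
      if (decode_concept c, decode_concept d) is (Some C, Some D)
      then Some (Or C D) else None
  | GenTree.Node 4 [:: c] => omap Not (decode_concept c)
  | GenTree.Node 5 [:: GenTree.Leaf (inr R); c] =>
      omap (Ex R) (decode_concept c)
  | GenTree.Node 6 [:: GenTree.Leaf (inr R); c] =>
      omap (All R) (decode_concept c)
  | _ => None
  end.

Lemma encode_conceptK : pcancel encode_concept decode_concept.
Proof.
by elim=> //= [C -> D ->|C -> D ->|C ->|R C ->|R C ->].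
Qed.

End ConceptEncoding.

HB.instance Definition _ (NC NR : eqType) :=
  Equality.copy (concept NC NR) (pcan_type (@encode_conceptK NC NR)).
HB.instance Definition _ (NC NR : choiceType) :=
  Choice.copy (concept NC NR) (pcan_type (@encode_conceptK NC NR)).

(* [nnf_pol true C] is the negation normal form of [C] and [nnf_pol false C]
   that of [Not C]. *)
Fixpoint nnf_pol (NC NR : Type) (b : bool) (C : concept NC NR) :
    concept NC NR :=
  match C with
  | Top => if b then Top else Bot
  | Bot => if b then Bot else Top
  | Atom A => if b then Atom A else Not (Atom A)
  | And C D => (if b then And else Or) (nnf_pol b C) (nnf_pol b D)
  | Or C D => (if b then Or else And) (nnf_pol b C) (nnf_pol b D)
  | Not C => nnf_pol (~~ b) C
  | Ex R C => (if b then Ex else All) R (nnf_pol b C)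
  | All R C => (if b then All else Ex) R (nnf_pol b C)
  end.

Definition nnf (NC NR : Type) (C : concept NC NR) := nnf_pol true C.

(* A concept is a conjunct of itself, and intermediate conjunctions count: if
   [D] is itself a conjunction, it is still a conjunct of [And C D]. Otherwise
   the rules below that form [And C D] could be applied forever. *)
Fixpoint conjunct (NC NR : eqType) (D C : concept NC NR) : bool :=
  (D == C) ||
  (if C is And C1 C2 then conjunct D C1 || conjunct D C2 else false).

(* [(E, F) \in gcis] is E ⊑ F, [(R, S) \in role_incls] is R ⊑ S,
   [S \in transitives] is S ∘ S ⊑ S, [(a, C) \in concept_asserts] is {a} ⊑ C
   and [(a, R, b) \in role_asserts] is {(a, b)} ⊑ R. *)
Record ontology (NC NR NI : choiceType) := Ontology {
  gcis : {fset concept NC NR * concept NC NR};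
  role_incls : {fset NR * NR};
  transitives : {fset NR};
  concept_asserts : {fset NI * concept NC NR};
  role_asserts : {fset NI * NR * NI} }.

(** * Set-theoretic semantics *)

Record interpretation (NC NR NI : Type) := Interpretation {
  dom : Type;
  dom_inhabited : inhabited dom;
  int_concept : NC -> dom -> Prop;
  int_role : NR -> dom -> dom -> Prop;
  int_ind : NI -> dom }.

Fixpoint eval (NC NR NI : Type) (I : interpretation NC NR NI)
    (C : concept NC NR) (d : dom I) : Prop :=
  match C with
  | Top => True
  | Bot => False
  | Atom A => int_concept A d
  | And C D => eval C d /\ eval D d
  | Or C D => eval C d \/ eval D d
  | Not C => ~ eval C d
  | Ex R C => exists e, int_role R d e /\ eval C e
  | All R C => forall e, int_role R d e -> eval C e
  end.

Record model (NC NR NI : choiceType) (O : ontology NC NR NI)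
    (I : interpretation NC NR NI) : Prop := Model {
  model_gci : forall E F, (E, F) \in gcis O ->
    forall d : dom I, eval E d -> eval F d;
  model_role_incl : forall R S, (R, S) \in role_incls O ->
    forall d e : dom I, int_role R d e -> int_role S d e;
  model_transitive : forall S, S \in transitives O ->
    forall d e f : dom I, int_role S d e -> int_role S e f -> int_role S d f;
  model_concept_assert : forall a C, (a, C) \in concept_asserts O ->
    eval C (int_ind I a);
  model_role_assert : forall a R b, (a, R, b) \in role_asserts O ->
    int_role R (int_ind I a) (int_ind I b) }.

Definition consistent (NC NR NI : choiceType) (O : ontology NC NR NI) : Prop :=
  exists I : interpretation NC NR NI, model O I.

(** * Tableaux *)

Definition role_sub (NC NR NI : choiceType) (O : ontology NC NR NI) :
    NR -> NR -> Prop :=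
  clos_refl_trans NR (fun R S => (R, S) \in role_incls O).

(* [inl a] is the node x^a; [inr n] are the nodes created by the ∃-rule. *)
Definition node (NI : Type) : Type := (NI + nat)%type.
HB.instance Definition _ (NI : choiceType) := Choice.on (node NI).

(* Labels also contain the nominals {a}, which are not SH concepts. *)
Definition item (NC NR NI : Type) : Type := (NI + concept NC NR)%type.
HB.instance Definition _ (NC NR NI : choiceType) := Choice.on (item NC NR NI).

Definition inom {NC NR NI : Type} (a : NI) : item NC NR NI := inl a.
Definition icon {NC NR NI : Type} (C : concept NC NR) : item NC NR NI := inr C.

(* An edge [(x, R, y)] also records the role [R] for which it was created; the
   S-successor relation is derived from it in [succ]. *)
Record tableau (NC NR NI : choiceType) := Tableau {
  nodes : {fset node NI};
  edges : {fset node NI * NR * node NI};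
  label : node NI -> {fset item NC NR NI} }.

Section Tableaux.
Variables (NC NR : choiceType) (NI : finType) (O : ontology NC NR NI).

Local Notation node := (node NI).
Local Notation item := (item NC NR NI).
Local Notation tableau := (tableau NC NR NI).
Local Notation "R ⊑* S" := (role_sub O R S) (at level 70).

Definition ind (a : NI) : node := inl a.

Definition succ (T : tableau) (S : NR) (x y : node) : Prop :=
  exists2 R : NR, (x, R, y) \in edges T & R ⊑* S.

(* Role assertions may create cycles between the x^a, so a node must be excluded
   explicitly from its own ancestors; otherwise it would block itself. *)
Definition ancestor (T : tableau) (x' x : node) : Prop :=
  x' <> x /\
  clos_trans node (fun u v => exists R : NR, (u, R, v) \in edges T) x' x.

Definition blocked (T : tableau) (x : node) : Prop :=
  exists2 x' : node, ancestor T x' x & label T x `<=` label T x'.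

Definition add (T : tableau) (x : node) (X : {fset item}) : tableau :=
  Tableau (nodes T) (edges T)
    (fun z => if z == x then label T z `|` X else label T z).

Definition add_node (T : tableau) (x : node) (R : NR) (y : node)
    (D : concept NC NR) : tableau :=
  Tableau (y |` nodes T) ((x, R, y) |` edges T)
    (fun z => if z == y then [fset icon D] else label T z).

Definition init : tableau :=
  Tableau
    [fset ind a | a in NI]
    [fset (ind e.1.1, e.1.2, ind e.2) | e in role_asserts O]
    (fun x => if x is inl a then
       inom a |` [fset icon (nnf c.2) | c in concept_asserts O & c.1 == a]
     else fset0).

Inductive step (T : tableau) : tableau -> Prop :=
| step_gci E F x :
    (E, F) \in gcis O -> x \in nodes T ->
    icon (nnf (Or (Not E) F)) \notin label T x ->
    step T (add T x [fset icon (nnf (Or (Not E) F))])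
| step_and D1 D2 x :
    x \in nodes T -> icon (And D1 D2) \in label T x ->
    ~~ ([fset icon D1; icon D2] `<=` label T x) ->
    step T (add T x [fset icon D1; icon D2])
| step_or D1 D2 D x :
    x \in nodes T -> icon (Or D1 D2) \in label T x ->
    [fset icon D1; icon D2] `&` label T x = fset0 ->
    D = D1 \/ D = D2 ->
    step T (add T x [fset icon D])
| step_ex R D x y :
    x \in nodes T -> icon (Ex R D) \in label T x ->
    ~ (exists2 z, succ T R x z & icon D \in label T z) ->
    ~ blocked T x ->
    y \notin nodes T ->
    step T (add_node T x R y D)
| step_all R D x y :
    x \in nodes T -> icon (All R D) \in label T x ->
    succ T R x y -> icon D \notin label T y ->
    step T (add T y [fset icon D])
| step_all_ex P C R D x y :
    x \in nodes T ->
    icon (Ex P C) \in label T x -> icon (All R D) \in label T x ->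
    ~~ conjunct D C ->
    succ T P x y -> icon C \in label T y -> icon D \in label T y ->
    P ⊑* R ->
    icon (Ex P (And C D)) \notin label T x ->
    step T (add (add T x [fset icon (Ex P (And C D))]) y [fset icon (And C D)])
| step_all_ex_assert a b P R D :
    (a, P, b) \in role_asserts O ->
    icon (All R D) \in label T (ind a) ->
    P ⊑* R -> icon D \in label T (ind b) ->
    icon (Ex P D) \notin label T (ind a) ->
    step T (add T (ind a) [fset icon (Ex P D)])
| step_allp R S D x y :
    x \in nodes T -> icon (All R D) \in label T x ->
    S \in transitives O -> S ⊑* R ->
    succ T S x y -> icon (All S D) \notin label T y ->
    step T (add T y [fset icon (All S D)])
| step_allp_ex P C R S D x y :
    x \in nodes T ->
    icon (Ex P C) \in label T x -> icon (All R D) \in label T x ->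
    S \in transitives O -> S ⊑* R -> P ⊑* S ->
    ~~ conjunct (All S D) C ->
    succ T P x y -> icon C \in label T y -> icon (All S D) \in label T y ->
    icon (Ex P (And C (All S D))) \notin label T x ->
    step T (add (add T x [fset icon (Ex P (And C (All S D)))])
                y [fset icon (And C (All S D))])
| step_allp_ex_assert a b P R S D :
    (a, P, b) \in role_asserts O ->
    icon (All R D) \in label T (ind a) ->
    icon (All S D) \in label T (ind b) ->
    S \in transitives O -> S ⊑* R -> P ⊑* S ->
    icon (Ex P (All S D)) \notin label T (ind a) ->
    step T (add (add T (ind a) [fset icon (Ex P (All S D))])
                (ind b) [fset icon (All S D)]).

Definition complete (T : tableau) : Prop := forall T', ~ step T T'.

Definition tableau_for (T : tableau) : Prop :=
  clos_refl_trans tableau step init T /\ complete T.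

(* Since [Bot] is a primitive concept, its occurrence in a label is a clash, as
   usual; it plays the role of a pair A, ¬A. *)
Definition clash (T : tableau) : Prop :=
  exists2 x : node, x \in nodes T &
    icon Bot \in label T x \/
    exists A : NC,
      icon (Atom A) \in label T x /\ icon (Not (Atom A)) \in label T x.

Definition clash_free (T : tableau) : Prop := ~ clash T.

End Tableaux.

(* Main.v *)
(* A complete clash-free tableau yields a model on its nodes: a node also takes
   over the successors of every node with a larger label, so a blocked node sees
   the successors of an unblocked ancestor, and transitive roles are closed under
   transitivity. Conversely, given a model, the choices in the ⊔-rule can be made
   so that the tableau maps into the model. Every run terminates: all labels lie
   in a finite closure of the ontology, and a node is determined by the sequence
   of (label, existential concept) pairs at which the path to it was expanded, in
   which no label is repeated because an expanded node is not blocked. *)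
Require Import Defs.
From Stdlib Require Import Relation_Operators Operators_Properties Classical.
From mathcomp Require Import all_boot finmap.

Set Implicit Arguments.
Unset Strict Implicit.
Unset Printing Implicit Defensive.

Local Open Scope fset_scope.

Lemma uniq_seqs_finite (K : choiceType) (X : seq K) :
  exists B : {fset seq K}, forall s, uniq s -> {subset s <= X} -> s \in B.
Proof.
have [B HB] : exists B : {fset seq K}, forall s,
    size s <= size X -> {subset s <= X} -> s \in B.
  elim: (size X) => [|n [B HB]].
    by exists [fset [::]] => s; rewrite leqn0 size_eq0 => /eqP-> _; rewrite inE.
  exists ([::] |` [fset x :: s | x in X, s in B]) => -[|x s] /=.
    by rewrite !inE.
  move=> sz sub; rewrite !inE /=; apply/imfset2P.
  exists x; first by apply: sub; rewrite inE eqxx.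
  by exists s => //; apply: HB => // y ys; apply: sub; rewrite inE ys orbT.
by exists B => s us sub; apply: HB => //; apply: uniq_leq_size.
Qed.

Fixpoint is_nnf (NC NR : Type) (C : concept NC NR) : bool :=
  match C with
  | Top | Bot | Atom _ => true
  | And C D | Or C D => is_nnf C && is_nnf D
  | Not C => if C is Atom _ then true else false
  | Ex _ C | All _ C => is_nnf C
  end.

Lemma is_nnf_nnf_pol (NC NR : Type) (b : bool) (C : concept NC NR) :
  is_nnf (nnf_pol b C).
Proof.
elim: C b => [||A|C IC D ID|C IC D ID|C IC|R C IC|R C IC] [] //=;
  by rewrite IC ?ID.
Qed.

Lemma eval_nnf_pol (NC NR NI : Type) (I : interpretation NC NR NI)
    (C : concept NC NR) (b : bool) (d : dom I) :
  eval (nnf_pol b C) d <-> (if b then eval C d else ~ eval C d).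
Proof.
elim: C b d => [||A|C IC D ID|C IC D ID|C IC|R C IC|R C IC] [] d /=; try tauto.
- by rewrite (IC true) (ID true).
- rewrite (IC false) (ID false).
  by case: (classic (eval C d)); case: (classic (eval D d)); tauto.
- by rewrite (IC true) (ID true).
- by rewrite (IC false) (ID false); tauto.
- by rewrite (IC false).
- by rewrite (IC true); split; [tauto|apply: NNPP].
- by split=> -[e [Re Ce]]; exists e; split=> //; apply/(IC true e).
- split=> [H [e [Re Ce]]|H e Re]; first exact: (proj1 (IC false e) (H e Re)).
  by apply/(IC false) => Ce; apply: H; exists e.
- by split=> H e Re; apply/(IC true e); apply: H.
- split=> [[e [Re /(IC false) nCe]] H|H]; first by apply/nCe/H.
  apply: NNPP => nE; apply: H => e Re; apply: NNPP => nCe; apply: nE.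
  by exists e; split=> //; apply/(IC false).
Qed.

Section Tableaux.
Variables (NC NR : choiceType) (NI : finType) (O : ontology NC NR NI).

Local Notation node := (node NI).
Local Notation item := (item NC NR NI).
Local Notation tableau := (tableau NC NR NI).
Local Notation concept := (concept NC NR).
Local Notation reach := (clos_refl_trans tableau (@step NC NR NI O)).
Local Notation icon := (@icon NC NR NI).
Local Notation inom := (@inom NC NR NI).

Lemma reach_ind (Inv : tableau -> Prop) :
  Inv (init O) -> (forall T T', Inv T -> step O T T' -> Inv T') ->
  forall T, reach (init O) T -> Inv T.
Proof.
move=> I0 IS T; elim/clos_refl_trans_ind_left => // U V _ IU UV.
exact: IS UV.
Qed.

Lemma label_add_mem (T : tableau) x (X : {fset item}) z i :
  (i \in label (add T x X) z) = (i \in label T z) || ((z == x) && (i \in X)).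
Proof. by rewrite /=; case: eqP => _ //=; rewrite ?in_fsetU ?orbF. Qed.

(** * Shape of a rule application *)

Record tableau_wf (T : tableau) : Prop := TableauWf {
  wf_ind : forall a, ind a \in nodes T;
  wf_edge : forall x R y, (x, R, y) \in edges T ->
    (x \in nodes T) && (y \in nodes T);
  wf_inom : forall x a, inom a \in label T x <-> x = ind a }.

Record grows (T T' : tableau) : Prop := Grows {
  grows_nodes : nodes T' = nodes T;
  grows_edges : edges T' = edges T;
  grows_label : forall z, label T z `<=` label T' z;
  grows_inom : forall z a, inom a \in label T' z -> inom a \in label T z }.

Definition gains (T T' : tableau) : Prop :=
  exists2 x, x \in nodes T & exists2 i, i \in label T' x & i \notin label T x.

Variant step_spec (T T' : tableau) : Prop :=
| StepGrow of grows T T' & gains T T'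
| StepNew R D x y of x \in nodes T & icon (Ex R D) \in label T x
    & ~ (exists2 z, succ O T R x z & icon D \in label T z)
    & ~ blocked T x & y \notin nodes T & T' = add_node T x R y D.

Lemma grows_add T x (X : {fset item}) :
  (forall a, inom a \notin X) -> grows T (add T x X).
Proof.
move=> nX; split=> // [z|z a].
  by apply/fsubsetP => i iz; rewrite label_add_mem iz.
by rewrite label_add_mem (negbTE (nX a)) andbF orbF.
Qed.

Lemma grows_trans T1 T2 T3 : grows T1 T2 -> grows T2 T3 -> grows T1 T3.
Proof.
case=> [n1 e1 l1 i1] [n2 e2 l2 i2]; split; rewrite ?n2 ?e2 //.
  by move=> z; apply: fsubset_trans (l1 z) (l2 z).
by move=> z a /i2/i1.
Qed.

Lemma gains_add T x (X : {fset item}) i :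
  x \in nodes T -> i \in X -> i \notin label T x -> gains T (add T x X).
Proof.
by move=> xT iX ix; exists x => //; exists i => //; rewrite label_add_mem eqxx iX orbT.
Qed.

Lemma gains_grows T1 T2 T3 : gains T1 T2 -> grows T2 T3 -> gains T1 T3.
Proof.
case=> x xT [i i2 i1] g; exists x => //; exists i => //.
exact: (fsubsetP (grows_label g x)).
Qed.

Lemma inom_notin1 C a : inom a \notin [fset icon C].
Proof. by rewrite in_fset1. Qed.

Lemma inom_notin2 C D a : inom a \notin [fset icon C; icon D].
Proof. by rewrite in_fset2. Qed.

Lemma succ_node T S x y : tableau_wf T -> succ O T S x y -> y \in nodes T.
Proof. by move=> w [R /(wf_edge w)/andP[]]. Qed.

Lemma step_specP T T' : tableau_wf T -> step O T T' -> step_spec T T'.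
Proof.
have n1 := inom_notin1; have n2 := inom_notin2.
move=> w; case=> {T'}.
- move=> E F x _ xT nx; apply: StepGrow; first exact: grows_add.
  by apply: gains_add nx; rewrite ?in_fset1.
- move=> D1 D2 x xT _ nx; apply: StepGrow; first exact: grows_add.
  have /fsubsetPn[i iX ix] := nx.
  exact: gains_add ix.
- move=> D1 D2 D x xT _ d0 Di; apply: StepGrow; first exact: grows_add.
  apply: (@gains_add _ _ _ (icon D)); rewrite ?in_fset1 //.
  apply/negP => Dx; have /fsetP/(_ (icon D)) := d0.
  by rewrite in_fsetI Dx in_fset2 in_fset0; case: Di => ->; rewrite eqxx ?orbT.
- move=> R D x y *; exact: (@StepNew _ _ R D x y).
- move=> R D x y xT _ xy ny; apply: StepGrow; first exact: grows_add.
  by apply: gains_add ny; rewrite ?in_fset1 // (succ_node w xy).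
- move=> P C R D x y xT _ _ _ _ _ _ _ nx; apply: StepGrow.
    by apply: grows_trans; apply: grows_add.
  apply: gains_grows; last by apply: grows_add.
  by apply: gains_add nx; rewrite ?in_fset1.
- move=> a b P R D _ _ _ _ nx; apply: StepGrow; first exact: grows_add.
  by apply: gains_add nx; rewrite ?in_fset1 // wf_ind.
- move=> R S D x y xT _ _ _ xy ny; apply: StepGrow; first exact: grows_add.
  by apply: gains_add ny; rewrite ?in_fset1 // (succ_node w xy).
- move=> P C R S D x y xT _ _ _ _ _ _ _ _ _ nx; apply: StepGrow.
    by apply: grows_trans; apply: grows_add.
  apply: gains_grows; last by apply: grows_add.
  by apply: gains_add nx; rewrite ?in_fset1.
- move=> a b P R S D _ _ _ _ _ _ nx; apply: StepGrow.
    by apply: grows_trans; apply: grows_add.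
  apply: gains_grows; last by apply: grows_add.
  by apply: gains_add nx; rewrite ?in_fset1 // wf_ind.
Qed.

Lemma tableau_wf_init : tableau_wf (init O).
Proof.
split=> [a|x R y|x a] /=.
- by rewrite in_imfset.
- by case/imfsetP => -[[a P] b] /= _ [-> _ ->]; rewrite !in_imfset.
- case: x => [b|n] /=; last by rewrite in_fset0.
  rewrite in_fset1U; split.
    case/orP=> [/eqP[->]//|/imfsetP[c _ //]].
  by case=> ->; rewrite eqxx.
Qed.

Lemma tableau_wf_step T T' : tableau_wf T -> step O T T' -> tableau_wf T'.
Proof.
move=> w /(step_specP w)[[nE eE lS iS] _|R D x y xT _ _ _ yT ->].
  split=> [a|x R y|x a]; rewrite ?nE ?eE; [exact: wf_ind|exact: (wf_edge w)|].
  by rewrite -(wf_inom w); split=> [/iS//|/(fsubsetP (lS x))].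
split=> [a|u S v|z a] /=.
- by rewrite in_fset1U wf_ind ?orbT.
- rewrite !in_fset1U; case/orP=> [/eqP[-> _ ->]|/(wf_edge w)/andP[-> ->]].
    by rewrite xT eqxx orbT.
  by rewrite !orbT.
- case: eqP => [->|_]; last exact: wf_inom.
  rewrite in_fset1; split=> // ya.
  by rewrite ya (wf_ind w) in yT.
Qed.

Lemma tableau_wf_reach T : reach (init O) T -> tableau_wf T.
Proof. exact: reach_ind tableau_wf_init tableau_wf_step T. Qed.

(** * Invariants of labels *)

Record rule_closed (Q : concept -> Prop) : Prop := RuleClosed {
  closed_gci : forall E F, (E, F) \in gcis O -> Q (nnf (Or (Not E) F));
  closed_assert : forall a C, (a, C) \in concept_asserts O -> Q (nnf C);
  closed_and : forall C D, Q (And C D) -> Q C /\ Q D;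
  closed_or : forall C D, Q (Or C D) -> Q C /\ Q D;
  closed_ex : forall R D, Q (Ex R D) -> Q D;
  closed_all : forall R D, Q (All R D) -> Q D;
  closed_allp : forall R S D, S \in transitives O -> Q (All R D) -> Q (All S D);
  closed_all_ex : forall P C R D, Q (Ex P C) -> Q (All R D) ->
    ~~ conjunct D C -> Q (And C D) /\ Q (Ex P (And C D));
  closed_allp_ex : forall P C R S D, Q (Ex P C) -> Q (All R D) ->
    S \in transitives O -> ~~ conjunct (All S D) C ->
    Q (And C (All S D)) /\ Q (Ex P (And C (All S D)));
  closed_all_ex_assert : forall a P b R D, (a, P, b) \in role_asserts O ->
    Q (All R D) -> Q (Ex P D);
  closed_allp_ex_assert : forall a P b R S D, (a, P, b) \in role_asserts O ->
    Q (All R D) -> S \in transitives O -> Q (Ex P (All S D)) }.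

Definition labelled (Q : concept -> Prop) (T : tableau) : Prop :=
  forall x C, icon C \in label T x -> Q C.

Lemma labelled_add Q T x C :
  labelled Q T -> Q C -> labelled Q (add T x [fset icon C]).
Proof.
move=> lT QC z E; rewrite label_add_mem => /orP[/lT//|/andP[_]].
by rewrite in_fset1 => /eqP[->].
Qed.

Lemma labelled_step Q T T' :
  rule_closed Q -> labelled Q T -> step O T T' -> labelled Q T'.
Proof.
move=> c lT; case=> {T'}.
- by move=> E F x EF _ _; apply: labelled_add => //; apply: closed_gci EF.
- move=> D1 D2 x _ /lT/(closed_and c)[Q1 Q2] _ z E.
  rewrite label_add_mem => /orP[/lT//|/andP[_]].
  by rewrite in_fset2 => /orP[]/eqP[->].
- move=> D1 D2 D x _ /lT/(closed_or c)[Q1 Q2] _ DD; apply: labelled_add => //.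
  by case: DD => ->.
- move=> R D x y _ /lT/(closed_ex c) QD _ _ _ z E /=; case: eqP => _.
    by rewrite in_fset1 => /eqP[->].
  exact: lT.
- by move=> R D x y _ /lT/(closed_all c) QD _ _; apply: labelled_add.
- move=> P C R D x y _ /lT h1 /lT h2 h3 _ _ _ _ _.
  have [hA hE] := closed_all_ex c h1 h2 h3.
  by apply: labelled_add => //; apply: labelled_add.
- move=> a b P R D h1 /lT h2 _ _ _; apply: labelled_add => //.
  exact: closed_all_ex_assert h1 h2.
- move=> R S D x y _ /lT h1 h2 _ _ _; apply: labelled_add => //.
  exact: closed_allp h2 h1.
- move=> P C R S D x y _ /lT h1 /lT h2 h3 _ _ h4 _ _ _ _.
  have [hA hE] := closed_allp_ex c h1 h2 h3 h4.
  by apply: labelled_add => //; apply: labelled_add.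
- move=> a b P R S D h1 /lT h2 _ h3 _ _ _.
  apply: labelled_add; last exact: closed_allp h3 h2.
  by apply: labelled_add => //; apply: closed_allp_ex_assert h1 h2 h3.
Qed.

Lemma labelled_init Q : rule_closed Q -> labelled Q (init O).
Proof.
move=> c [a|n] C /=; last by rewrite in_fset0.
rewrite in_fset1U => /orP[//|/imfsetP[[b D] /=]].
by rewrite !inE /= => /andP[h _] [->]; apply: closed_assert h.
Qed.

Lemma labelled_reach Q T :
  rule_closed Q -> reach (init O) T -> labelled Q T.
Proof.
move=> c; apply: reach_ind; first exact: labelled_init.
by move=> U V; apply: labelled_step.
Qed.

Lemma rule_closed_nnf : rule_closed (fun C => is_nnf C).
Proof.
split=> //=; try (by move=> *; exact: is_nnf_nnf_pol);
  try (by move=> C D /andP).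
- by move=> E F _; rewrite !is_nnf_nnf_pol.
- by move=> P C _ D -> ->.
- by move=> P C _ S D -> ->.
Qed.

(** * From a complete clash-free tableau to a model *)

Lemma role_sub_trans R S Q : role_sub O R S -> role_sub O S Q -> role_sub O R Q.
Proof. exact: rt_trans. Qed.

Lemma succ_sub T R S x y : role_sub O R S -> succ O T R x y -> succ O T S x y.
Proof. by move=> RS [P e PR]; exists P => //; apply: role_sub_trans RS. Qed.

Definition ranked (T : tableau) : Prop :=
  exists2 rank : node -> nat,
    forall x R y, (x, R, y) \in edges T ->
      rank x < rank y \/ rank x = 0 /\ rank y = 0
    & forall x, x \in nodes T -> rank x = 0 -> exists a, x = ind a.

Lemma ranked_reach T : reach (init O) T -> ranked T.
Proof.
move=> rT; suff: tableau_wf T /\ ranked T by case.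
move: T rT; apply: reach_ind.
  split; first exact: tableau_wf_init.
  exists (fun=> 0) => [x R y _|x /imfsetP[a _ ->] _]; first by right.
  by exists a.
move=> T T' [w [rk rkP rk0]] st; split; first exact: tableau_wf_step st.
case: (step_specP w st) => [[nE eE _ _] _|R D x y xT _ _ _ yT ->].
  by exists rk; rewrite ?eE ?nE.
have ne z : z \in nodes T -> (z == y) = false.
  by move=> zT; apply: contraNF yT => /eqP<-.
exists (fun z => if z == y then (rk x).+1 else rk z) => [u S v|z] /=.
  rewrite in_fset1U => /orP[/eqP[-> _ ->]|uv].
    by left; rewrite eqxx ne.
  have /andP[uT vT] := wf_edge w uv.
  by rewrite !ne //; apply: rkP uv.
by rewrite in_fset1U; case: eqP => //= _ zT; apply: rk0.
Qed.

Lemma exists_unblocked T x :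
  tableau_wf T -> ranked T -> x \in nodes T ->
  exists b, [/\ b \in nodes T, label T x `<=` label T b & ~ blocked T b].
Proof.
move=> w [rk rkP rk0]; have [n le_n] := ubnP (rk x).
elim: n x le_n => // n IHn x le_n xT.
have [[x' [ne anc] sub]|nb] := classic (blocked T x); last by exists x.
have nind : rk x <> 0.
  move/(rk0 _ xT) => [a xa]; case: ne; rewrite xa; apply/(wf_inom w).
  by apply: (fsubsetP sub); apply/(wf_inom w).
have x'T : x' \in nodes T.
  by elim: anc => // u v [R /(wf_edge w)/andP[]].
have lt : rk x' < rk x.
  have [//|[_ /nind//]] : rk x' < rk x \/ rk x' = 0 /\ rk x = 0.
  elim: anc => [u v [R /rkP//]|u v z _ h1 _ h2].
  case: h1 h2 => [uv|[-> ->//]] [vz|[v0 _]]; last by rewrite v0 in uv.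
  by left; apply: ltn_trans vz.
have [b [bT sb nb]] := IHn x' (leq_trans lt le_n) x'T.
by exists b; split=> //; apply: fsubset_trans sub sb.
Qed.

Lemma exists_fresh (X : {fset node}) : exists y, y \notin X.
Proof.
pose f (x : node) := if x is inr n then n else 0.
exists (inr (\max_(x <- X) f x).+1); apply/negP => yX.
have := @leq_bigmax_seq _ _ xpredT f _ yX isT.
by rewrite /f ltnn.
Qed.

Section CompleteTableau.
Variables (T : tableau) (w : tableau_wf T) (rT : ranked T) (cT : complete O T).

Lemma complete_gci E F x : (E, F) \in gcis O -> x \in nodes T ->
  icon (nnf (Or (Not E) F)) \in label T x.
Proof. by move=> EF xT; apply: NNPP => /negP h; apply: (cT (step_gci EF xT h)). Qed.

Lemma complete_and D1 D2 x : x \in nodes T -> icon (And D1 D2) \in label T x ->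
  icon D1 \in label T x /\ icon D2 \in label T x.
Proof.
move=> xT h; have [/fsubsetP sub|/negP ns] :=
  classic (is_true ([fset icon D1; icon D2] `<=` label T x)).
  by split; apply: sub; rewrite in_fset2 eqxx ?orbT.
by case: (cT (step_and O xT h ns)).
Qed.

Lemma complete_or D1 D2 x : x \in nodes T -> icon (Or D1 D2) \in label T x ->
  icon D1 \in label T x \/ icon D2 \in label T x.
Proof.
move=> xT h; apply: NNPP => nD.
apply: (cT (step_or O xT h _ (or_introl erefl))).
apply/fsetP => i; rewrite in_fsetI in_fset2 in_fset0.
apply/negP => /andP[/orP[]/eqP-> ix]; apply: nD; [by left|by right].
Qed.

Lemma complete_ex R D x : x \in nodes T -> icon (Ex R D) \in label T x ->
  ~ blocked T x -> exists2 z, succ O T R x z & icon D \in label T z.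
Proof.
move=> xT h nb; apply: NNPP => nz; have [y yT] := exists_fresh (nodes T).
exact: (cT (step_ex xT h nz nb yT)).
Qed.

Lemma complete_all R D x y : x \in nodes T -> icon (All R D) \in label T x ->
  succ O T R x y -> icon D \in label T y.
Proof.
by move=> xT h xy; apply: NNPP => /negP ny; apply: (cT (step_all xT h xy ny)).
Qed.

Lemma complete_allp R S D x y : x \in nodes T -> icon (All R D) \in label T x ->
  S \in transitives O -> role_sub O S R -> succ O T S x y ->
  icon (All S D) \in label T y.
Proof.
move=> xT h St SR xy; apply: NNPP => /negP ny.
exact: (cT (step_allp xT h St SR xy ny)).
Qed.

(* A blocked node borrows the successors of a node with a larger label. *)
Definition unravel (S : NR) (x y : {x | x \in nodes T}) : Prop :=
  exists b, [/\ b \in nodes T, label T (val x) `<=` label T b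
    & succ O T S b (val y)].

Definition tableau_role (S : NR) (x y : {x | x \in nodes T}) : Prop :=
  unravel S x y \/
  exists2 Q, Q \in transitives O /\ role_sub O Q S & clos_trans _ (unravel Q) x y.

Definition tableau_ind (a : NI) : {x | x \in nodes T} := exist _ (ind a) (wf_ind w a).

Definition tableau_interpretation (a : NI) : interpretation NC NR NI :=
  @Interpretation NC NR NI {x | x \in nodes T} (inhabits (tableau_ind a))
    (fun A x => icon (Atom A) \in label T (val x)) tableau_role tableau_ind.

Lemma unravel_sub R S x y : role_sub O R S -> unravel R x y -> unravel S x y.
Proof. by move=> RS [b [bT sb /(succ_sub RS)]]; exists b. Qed.

Lemma unravel_all R D x y : icon (All R D) \in label T (val x) ->
  unravel R x y -> icon D \in label T (val y).
Proof. by move=> h [b [bT /fsubsetP sb]]; apply: complete_all (sb _ h). Qed.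

Lemma unravel_allp R S D x y : S \in transitives O -> role_sub O S R ->
  icon (All R D) \in label T (val x) ->
  unravel S x y -> icon (All S D) \in label T (val y).
Proof. by move=> St SR h [b [bT /fsubsetP sb]]; apply: complete_allp (sb _ h) St SR. Qed.

Lemma tableau_role_sub R S x y :
  role_sub O R S -> tableau_role R x y -> tableau_role S x y.
Proof.
move=> RS [/(unravel_sub RS)|[Q [Qt QR] c]]; first by left.
by right; exists Q => //; split=> //; apply: role_sub_trans RS.
Qed.

Lemma tableau_role_transitive S x y : S \in transitives O ->
  tableau_role S x y -> clos_trans _ (unravel S) x y.
Proof.
move=> St [|[Q [_ QS]]]; first exact: t_step.
elim=> [u v /(unravel_sub QS)|u v z _ h1 _]; first exact: t_step.
exact: t_trans h1.
Qed.

Lemma tableau_role_all R D x y : tableau_role R x y ->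
  icon (All R D) \in label T (val x) -> icon D \in label T (val y).
Proof.
case=> [xy /unravel_all/(_ xy)//|[Q [Qt QR] /clos_trans_t1n_iff c]].
have {c} [z xz zy] : exists2 z, unravel Q x z & z = y \/ clos_trans _ (unravel Q) z y.
  case: c => [z xz|z {}y xz /clos_trans_t1n_iff zy]; exists z => //; first by left.
  by right.
move=> h; have hQ := unravel_allp Qt QR h xz.
case: zy => [<-|zy]; first exact: unravel_all h (unravel_sub QR xz).
suff: icon D \in label T (val y) /\ icon (All Q D) \in label T (val y) by case.
elim: zy hQ => [u v uv hu|u v t _ IH1 _ IH2 /IH1[_ /IH2]//].
by split; [apply: unravel_all hu uv|apply: unravel_allp Qt (rt_refl _ _ _) hu uv].
Qed.

Lemma eval_label a (C : concept) (x : {x | x \in nodes T}) :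
  clash_free T -> is_nnf C -> icon C \in label T (val x) ->
  eval C (x : dom (tableau_interpretation a)).
Proof.
move=> cf; elim: C x => [||A|C IC D ID|C IC D ID|C _|R C IC|R C IC] x //=.
- by move=> _ hB; apply: cf; exists (val x); [exact: valP|left].
- move=> /andP[nC nD] /(complete_and (valP x))[hC hD].
  by split; [apply: IC|apply: ID].
- move=> /andP[nC nD] /(complete_or (valP x))[h|h]; [left|right].
    exact: IC.
  exact: ID.
- case: C => // A _ nA hA; apply: cf; exists (val x); first exact: valP.
  by right; exists A.
- move=> nC h; have [b [bT sb nb]] := exists_unblocked w rT (valP x).
  have [z bz hz] := complete_ex bT (fsubsetP sb _ h) nb.
  exists (exist _ z (succ_node w bz)); split; last exact: IC.
  by left; exists b.
- by move=> nC h y xy; apply: IC => //; apply: tableau_role_all h.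
Qed.

Lemma tableau_model a : edges (init O) `<=` edges T ->
  labelled (fun C => is_nnf C) T -> clash_free T ->
  (forall b C, (b, C) \in concept_asserts O -> icon (nnf C) \in label T (ind b)) ->
  model O (tableau_interpretation a).
Proof.
move=> sE lT cf lA; split=> [E F EF|R S RS|S St|b C bC|b R c bc].
- move=> x hE; have h := complete_gci EF (valP x).
  have /(eval_nnf_pol _ true)/= : eval (nnf (Or (Not E) F))
    (x : dom (tableau_interpretation a)) by apply: eval_label (lT _ _ h) h.
  by case=> // /(_ hE).
- by move=> x y; apply: tableau_role_sub; apply: rt_step.
- move=> x y z xy yz; right; exists S; first by split=> //; apply: rt_refl.
  by apply: t_trans; apply: tableau_role_transitive; [|exact: xy| |exact: yz].
- apply/(eval_nnf_pol _ true); have h := lA _ _ bC.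
  by apply: (@eval_label a (nnf C) (tableau_ind b)) => //; apply: lT h.
- left; exists (ind b); split=> //; first exact: wf_ind.
  exists R; last exact: rt_refl.
  apply: (fsubsetP sE); apply/imfsetP; by exists (b, R, c).
Qed.

End CompleteTableau.

Lemma init_sub T : reach (init O) T ->
  edges (init O) `<=` edges T /\ forall a, label (init O) (ind a) `<=` label T (ind a).
Proof.
move=> rT; suff [] : tableau_wf T /\ (edges (init O) `<=` edges T /\
  forall a, label (init O) (ind a) `<=` label T (ind a)) by [].
move: T rT; apply: reach_ind.
  by split; [exact: tableau_wf_init|split=> [|a]; exact: fsubset_refl].
move=> T T' [w [sE sL]] st; split; first exact: tableau_wf_step st.
case: (step_specP w st) => [[_ -> lS _] _|R D x y _ _ _ _ yT ->].
  by split=> // a; apply: fsubset_trans (sL a) (lS _).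
split=> [|a].
  by apply: fsubset_trans sE _; apply: fsubsetUr.
rewrite [label (add_node _ _ _ _ _) _]/=; case: eqP => // ya.
by rewrite -ya (wf_ind w) in yT.
Qed.

Lemma complete_clash_free_consistent T : 0 < #|NI| ->
  tableau_for O T -> clash_free T -> consistent O.
Proof.
move=> /card_gt0P[a _] [rT cT] cf; have [sE sL] := init_sub rT.
exists (tableau_interpretation (tableau_wf_reach rT) a).
apply: tableau_model => //; first exact: ranked_reach.
  exact: labelled_reach rule_closed_nnf rT.
move=> b C bC; apply: (fsubsetP (sL b)); rewrite /= in_fset1U; apply/orP; right.
by apply/imfsetP; exists (b, C) => //; rewrite !inE /= bC eqxx.
Qed.

(** * Satisfiable tableaux *)

Section Satisfiability.
Variables (I : interpretation NC NR NI) (mI : model O I).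

Definition satisfies (T : tableau) (pi : node -> dom I) : Prop :=
  [/\ forall x C, icon C \in label T x -> eval C (pi x),
      forall x R y, (x, R, y) \in edges T -> int_role R (pi x) (pi y)
    & forall a, pi (ind a) = int_ind I a].

Definition satisfiable (T : tableau) : Prop := exists pi, satisfies T pi.

Lemma int_role_sub R S (d e : dom I) :
  role_sub O R S -> int_role R d e -> int_role S d e.
Proof.
by elim=> [P Q PQ|//|P Q Q' _ h1 _ h2 /h1/h2//]; apply: (model_role_incl mI) PQ _ _.
Qed.

Lemma satisfies_succ T pi S x y :
  satisfies T pi -> succ O T S x y -> int_role S (pi x) (pi y).
Proof. by case=> _ sE _ [R /sE xy RS]; apply: int_role_sub xy. Qed.

Lemma satisfies_add T pi x C :
  satisfies T pi -> eval C (pi x) -> satisfies (add T x [fset icon C]) pi.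
Proof.
case=> sL sE sI h; split=> // z E; rewrite label_add_mem => /orP[/sL//|].
by case/andP=> /eqP->; rewrite in_fset1 => /eqP[->].
Qed.

Lemma satisfiable_init : satisfiable (init O).
Proof.
have [d0] := dom_inhabited I.
exists (fun x => if x is inl a then int_ind I a else d0); split=> //.
- case=> [a|n] C /=; last by rewrite in_fset0.
  rewrite in_fset1U => /orP[//|/imfsetP[[b D] /=]].
  rewrite !inE /= => /andP[h /eqP ba] [->]; apply/(eval_nnf_pol _ true).
  by rewrite -ba; apply: (model_concept_assert mI).
- move=> x R y /imfsetP[[[a P] b] /= h [-> -> ->]].
  exact: (model_role_assert mI).
Qed.

Lemma satisfiable_step T T' : tableau_wf T -> satisfiable T -> step O T T' ->
  exists2 T'', step O T T'' & satisfiable T''.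
Proof.
move=> w [pi spi] st; have [sL sE sI] := spi.
case: st (st) => {T'}.
- move=> E F x EF xT nx; exists (add T x [fset icon (nnf (Or (Not E) F))]) => //.
  exists pi; apply: satisfies_add => //; apply/(eval_nnf_pol _ true) => /=.
  by have [h|h] := classic (eval E (pi x)); [right; apply: (model_gci mI) EF _ h|left].
- move=> D1 D2 x xT /sL[h1 h2] nx st; exists (add T x [fset icon D1; icon D2]) => //.
  exists pi; split=> // z E; rewrite label_add_mem => /orP[/sL//|].
  by case/andP=> /eqP->; rewrite in_fset2 => /orP[]/eqP[->].
- move=> D1 D2 D x xT hx d0 _ _; have [h|h] := sL _ _ hx.
    exists (add T x [fset icon D1]); last by exists pi; apply: satisfies_add.
    by apply: step_or hx d0 _ => //; left.
  exists (add T x [fset icon D2]); last by exists pi; apply: satisfies_add.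
  by apply: step_or hx d0 _ => //; right.
- move=> R D x y xT /sL[e [xe De]] _ _ yT st; exists (add_node T x R y D) => //.
  have ne z : z \in nodes T -> (z == y) = false.
    by move=> zT; apply: contraNF yT => /eqP<-.
  exists (fun z => if z == y then e else pi z); split=> /= [z C|u S v|a].
  + case: eqP => // _; last exact: sL.
    by rewrite in_fset1 => /eqP[->].
  + rewrite in_fset1U => /orP[/eqP[-> -> ->]|uv]; first by rewrite eqxx ne.
    by have /andP[uT vT] := wf_edge w uv; rewrite !ne //; apply: sE.
  + by rewrite ne // wf_ind.
- move=> R D x y xT /sL h xy ny st; eexists; first exact: st.
  by exists pi; apply: satisfies_add => //; apply/h/(satisfies_succ spi xy).
- move=> P C R D x y xT _ _ _ xy /sL hC /sL hD _ _ st; eexists; first exact: st.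
  exists pi; apply: satisfies_add => //; apply: satisfies_add => //=.
  by exists (pi y); split=> //; apply: (satisfies_succ spi xy).
- move=> a b P R D ab _ _ /sL hD _ st; eexists; first exact: st.
  exists pi; apply: satisfies_add => //=; exists (pi (ind b)); split=> //.
  by rewrite !sI; apply: (model_role_assert mI).
- move=> R S D x y xT /sL h St SR xy _ st; eexists; first exact: st.
  exists pi; apply: satisfies_add => //= e ye; apply: h.
  apply: int_role_sub SR _; apply: (model_transitive mI) St _ _ _ _ ye.
  exact: (satisfies_succ spi xy).
- move=> P C R S D x y xT _ _ _ _ _ _ xy /sL hC /sL hD _ st; eexists; first exact: st.
  exists pi; apply: satisfies_add => //; apply: satisfies_add => //=.
  by exists (pi y); split=> //; apply: (satisfies_succ spi xy).
- move=> a b P R S D ab _ /sL hD _ _ _ _ st; eexists; first exact: st.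
  exists pi; apply: satisfies_add => //; apply: satisfies_add => //=.
  exists (pi (ind b)); split=> //.
  by rewrite !sI; apply: (model_role_assert mI).
Qed.

Lemma satisfiable_clash_free T : satisfiable T -> clash_free T.
Proof. by case=> pi [sL _ _] [x _ [/sL//|[A [/sL hA /sL]]]]; apply. Qed.

End Satisfiability.

(** * The finite closure of the ontology *)

Fixpoint subconcepts (C : concept) : seq concept :=
  C :: match C with
       | Top | Bot | Atom _ => [::]
       | And C D | Or C D => subconcepts C ++ subconcepts D
       | Not C | Ex _ C | All _ C => subconcepts C
       end.

Lemma subconcepts_refl C : C \in subconcepts C.
Proof. by case: C => * /=; rewrite in_cons eqxx. Qed.

Lemma subconcepts_trans C D E :
  C \in subconcepts D -> D \in subconcepts E -> C \in subconcepts E.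
Proof.
move=> CD; elim: E => [||A|E IE F IF|E IE F IF|E IE|R E IE|R E IE] /=;
  rewrite in_cons => /orP[/eqP DE|]; try (by rewrite DE in CD); rewrite ?mem_cat //.
- by case/orP=> [/IE|/IF] h; rewrite in_cons mem_cat h ?orbT.
- by case/orP=> [/IE|/IF] h; rewrite in_cons mem_cat h ?orbT.
- by move/IE=> h; rewrite in_cons h orbT.
- by move/IE=> h; rewrite in_cons h orbT.
- by move/IE=> h; rewrite in_cons h orbT.
Qed.

Definition base : seq concept :=
  flatten [seq subconcepts (nnf (Or (Not e.1) e.2)) | e <- gcis O]
  ++ flatten [seq subconcepts (nnf e.2) | e <- concept_asserts O].

Lemma base_sub C D : C \in subconcepts D -> D \in base -> C \in base.
Proof.
move=> CD; rewrite !mem_cat => /orP[]/flatten_mapP[e eO De]; apply/orP; [left|right];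
  apply/flatten_mapP; exists e => //; exact: subconcepts_trans De.
Qed.

Definition bodies : seq concept :=
  pmap (fun C => if C is All _ D then Some D else None) base.

Definition conjuncts : seq concept :=
  bodies ++ [seq All R D | R <- transitives O, D <- bodies].

Definition base_ex : seq (NR * concept) :=
  pmap (fun C => if C is Ex R D then Some (R, D) else None) base
  ++ [seq (e.1.2, D) | e <- role_asserts O, D <- conjuncts].

(* The rules that form [And C D] require that [D] is not a conjunct of [C], so
   they only extend a chain of pairwise distinct conjuncts. *)
Inductive closure : concept -> Prop :=
| closure_base C of C \in base : closure C
| closure_conjunct C of C \in conjuncts : closure C
| closure_chain P C s of (P, C) \in base_ex & uniq s & {subset s <= conjuncts} :
    closure (foldl And C s)
| closure_ex P C s of (P, C) \in base_ex & uniq s & {subset s <= conjuncts} :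
    closure (Ex P (foldl And C s)).

Lemma closure_finite : exists X : {fset concept}, forall C, closure C -> C \in X.
Proof.
have [B HB] := uniq_seqs_finite conjuncts.
exists [fset C in base ++ conjuncts
  ++ [seq foldl And e.2 s | e <- base_ex, s <- B]
  ++ [seq Ex e.1 (foldl And e.2 s) | e <- base_ex, s <- B]] => C.
rewrite in_fset /= !mem_cat.
case=> {C} [C|C|P C s PC us sub|P C s PC us sub].
- by rewrite mem_cat => ->.
- by rewrite mem_cat => ->; rewrite orbT.
- apply/orP; right; apply/orP; right; apply/orP; left.
  by apply/allpairsP; exists ((P, C), s); split=> //; apply: HB.
- apply/orP; right; apply/orP; right; apply/orP; right.
  by apply/allpairsP; exists ((P, C), s); split=> //; apply: HB.
Qed.

Lemma bodies_base D : D \in bodies -> D \in base.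
Proof.
rewrite mem_pmap => /mapP[[] // R E /base_sub h [->]]; apply: h.
by rewrite /= in_cons subconcepts_refl orbT.
Qed.

Lemma base_bodies R D : All R D \in base -> D \in bodies.
Proof. by move=> h; rewrite mem_pmap; apply/mapP; exists (All R D). Qed.

Lemma conjunctsP C : C \in conjuncts ->
  C \in bodies \/ exists S D, [/\ C = All S D, S \in transitives O & D \in bodies].
Proof.
rewrite mem_cat => /orP[|/allpairsP[[S D] /= [h1 h2 ->]]]; first by left.
by right; exists S, D.
Qed.

Lemma base_exP P C : (P, C) \in base_ex -> C \in base \/ C \in conjuncts.
Proof.
rewrite mem_cat => /orP[|/allpairsP[[e D] /= [_ h [_ ->]]]]; last by right.
rewrite mem_pmap => /mapP[[] // R E /base_sub h [_ ->]]; left; apply: h.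
by rewrite /= in_cons subconcepts_refl orbT.
Qed.

Definition chain_shape (C : concept) : Prop :=
  exists P C0 s D, [/\ C = And (foldl And C0 s) D, (P, C0) \in base_ex, uniq s,
    {subset s <= conjuncts} & D \in conjuncts].

Lemma closureP C : closure C ->
  [\/ C \in base,
      exists S D, [/\ C = All S D, S \in transitives O & D \in bodies],
      chain_shape C
    | exists P C0 s, [/\ C = Ex P (foldl And C0 s), (P, C0) \in base_ex, uniq s
        & {subset s <= conjuncts}]].
Proof.
have cj D : D \in conjuncts -> [\/ D \in base,
    exists S E, [/\ D = All S E, S \in transitives O & E \in bodies],
    chain_shape D
  | exists P C0 s, [/\ D = Ex P (foldl And C0 s), (P, C0) \in base_ex, uniq s
      & {subset s <= conjuncts}]].
  case/conjunctsP=> [/bodies_base|h]; [by constructor 1|by constructor 2].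
case=> {C} [C h|C /cj//|P C s|P C s h us sub].
- by constructor 1.
- case/lastP: s => [/base_exP[h|/cj//] _ _|s D h]; first by constructor 1.
  rewrite rcons_uniq foldl_rcons => /andP[_ us] sub; constructor 3.
  exists P, C, s, D; split=> // [E Es|]; apply: sub; rewrite mem_rcons in_cons ?Es ?orbT //.
  by rewrite eqxx.
- by constructor 4; exists P, C, s.
Qed.

Lemma closure_all R D : closure (All R D) -> D \in bodies.
Proof.
case/closureP=> [/base_bodies//|[S [E [[_ ->]]]]//|[P [C [s [E []]]]]//|].
by case=> P [C [s []]].
Qed.

Lemma closure_exP P C : closure (Ex P C) ->
  exists C0 s, [/\ C = foldl And C0 s, (P, C0) \in base_ex, uniq s
    & {subset s <= conjuncts}].
Proof.
case/closureP=> [h|[S [E []]]//|[Q [C0 [s [E []]]]]//|[Q [C0 [s [[-> ->] h1 h2 h3]]]]].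
  exists C, [::]; split=> //; rewrite mem_cat mem_pmap; apply/orP; left.
  by apply/mapP; exists (Ex P C).
by exists C0, s.
Qed.

Lemma conjunct_refl (C : concept) : conjunct C C.
Proof. by case: C => *; rewrite /conjunct -/conjunct eqxx. Qed.

Lemma conjunct_foldl (C D : concept) s : D \in s -> conjunct D (foldl And C s).
Proof.
elim/last_ind: s => // s E IH; rewrite mem_rcons in_cons foldl_rcons /=.
by case/orP=> [/eqP<-|/IH->]; rewrite ?conjunct_refl ?orbT.
Qed.

Lemma closure_extend P C D : closure (Ex P C) -> D \in conjuncts ->
  ~~ conjunct D C -> closure (And C D) /\ closure (Ex P (And C D)).
Proof.
move=> /closure_exP[C0 [s [-> h us sub]]] Dc nD.
rewrite -foldl_rcons; suff [u' s'] : uniq (rcons s D) /\ {subset rcons s D <= conjuncts}.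
  by split; [apply: closure_chain h u' s'|apply: closure_ex].
split; first by rewrite rcons_uniq us andbT; apply: contra nD; apply: conjunct_foldl.
by move=> E; rewrite mem_rcons in_cons => /orP[/eqP->//|/sub].
Qed.

Lemma bodies_conjuncts D : D \in bodies -> D \in conjuncts.
Proof. by rewrite mem_cat => ->. Qed.

Lemma allp_conjuncts S D :
  S \in transitives O -> D \in bodies -> All S D \in conjuncts.
Proof.
by move=> St Db; rewrite mem_cat; apply/orP; right; apply/allpairsP; exists (S, D).
Qed.

Lemma closure_ex_assert a P b D :
  (a, P, b) \in role_asserts O -> D \in conjuncts -> closure (Ex P D).
Proof.
move=> ab Dc; apply: (@closure_ex P D [::]) => //; rewrite mem_cat; apply/orP; right.
by apply/allpairsP; exists ((a, P, b), D).
Qed.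

Lemma rule_closed_closure : rule_closed closure.
Proof.
split.
- move=> E F EF; apply: closure_base; rewrite mem_cat; apply/orP; left.
  by apply/flatten_mapP; exists (E, F) => //; apply: subconcepts_refl.
- move=> a C aC; apply: closure_base; rewrite mem_cat; apply/orP; right.
  by apply/flatten_mapP; exists (a, C) => //; apply: subconcepts_refl.
- move=> C D /closureP[h|[S [E []]]//|[P [C0 [s [E [[-> ->] h us sub Ec]]]]]|].
  + split; apply: closure_base; apply: base_sub h;
      by rewrite /= in_cons mem_cat subconcepts_refl ?orbT.
  + by split; [apply: closure_chain h us sub|apply: closure_conjunct].
  + by case=> P [C0 [s []]].
- move=> C D /closureP[h|[S [E []]]//|[P [C0 [s [E []]]]]//|].
  + split; apply: closure_base; apply: base_sub h;
      by rewrite /= in_cons mem_cat subconcepts_refl ?orbT.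
  + by case=> P [C0 [s []]].
- by move=> R D /closure_exP[C0 [s [-> h us sub]]]; apply: closure_chain h us sub.
- by move=> R D /closure_all/bodies_base; apply: closure_base.
- by move=> R S D St /closure_all/(allp_conjuncts St); apply: closure_conjunct.
- by move=> P C R D hC /closure_all/bodies_conjuncts; apply: closure_extend.
- by move=> P C R S D hC /closure_all hD St; apply: closure_extend => //; apply: allp_conjuncts.
- by move=> a P b R D ab /closure_all/bodies_conjuncts; apply: closure_ex_assert ab.
- by move=> a P b R S D ab /closure_all hD /allp_conjuncts/(_ hD); apply: closure_ex_assert ab.
Qed.

Lemma labels_finite : exists L : {fset item},
  forall T, reach (init O) T -> forall x, label T x `<=` L.
Proof.
have [X HX] := closure_finite.
exists ([fset inom a | a in NI] `|` [fset icon C | C in X]) => T rT x.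
apply/fsubsetP => -[a|C] h; rewrite in_fsetU; apply/orP; [left|right].
  by apply/imfsetP; exists a.
by apply/imfsetP; exists C => //; apply/HX/(labelled_reach rule_closed_closure rT h).
Qed.

(** * Termination *)

(* The address of a node consists of the individual node at the root of its tree
   and, for each ∃-rule application on the path to it, the label of the expanded
   node at that moment and the existential concept. As the expanded node was not
   blocked and labels only grow, the labels in an address are distinct. *)
Definition address : Type := (node * seq ({fset item} * item))%type.

Record addressing (L : {fset item}) (T : tableau) (addr : node -> address) : Prop :=
  Addressing {
  addr_inj : {in nodes T &, injective addr};
  addr_root : forall x, x \in nodes T -> (addr x).1 \in nodes (init O);
  addr_uniq : forall x, x \in nodes T -> uniq (map fst (addr x).2);
  addr_sub : forall x, x \in nodes T ->
    {subset (addr x).2 <= (fpowerset L `*` L)%fset};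
  addr_ancestor : forall x A, x \in nodes T -> A \in map fst (addr x).2 ->
    exists2 x', ancestor T x' x & A `<=` label T x';
  addr_parent : forall z r s A R D, z \in nodes T ->
    addr z = (r, rcons s (A, icon (Ex R D))) ->
    exists x, [/\ x \in nodes T, addr x = (r, s), (x, R, z) \in edges T
      & icon D \in label T z] }.

Lemma addressing_init L : addressing L (init O) (fun x => (x, [::])).
Proof. by split=> //= [x y _ _ []//|z r [|? ?]]. Qed.

Lemma addressing_grows L T T' addr :
  grows T T' -> addressing L T addr -> addressing L T' addr.
Proof.
case=> nE eE lS _ [h1 h2 h3 h4 h5 h6]; split; rewrite ?nE ?eE //.
- move=> x A xT Ax; have [x' anc sA] := h5 x A xT Ax.
  exists x'; first by rewrite /ancestor eE.
  exact: fsubset_trans (lS x').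
- move=> z r s A R D zT /(h6 _ _ _ _ _ _ zT)[x [xT ax xz Dz]].
  by exists x; split=> //; apply: (fsubsetP (lS z)).
Qed.

Lemma ancestor_nodes T x' x : tableau_wf T -> ancestor T x' x -> x' \in nodes T.
Proof. by move=> w [_]; elim=> // u v [R /(wf_edge w)/andP[]]. Qed.

Lemma ancestor_new (T : tableau) x R y D x' z :
  ancestor T x' z -> ancestor (add_node T x R y D) x' z.
Proof.
case=> ne anc; split=> //; elim: anc => [u v [S uv]|u v t _ h1 _ h2].
  by apply: t_step; exists S; rewrite /= in_fset1U uv orbT.
exact: t_trans h1 h2.
Qed.

Lemma addressing_new L T addr x R y D :
  tableau_wf T -> addressing L T addr -> label T x `<=` L ->
  x \in nodes T -> icon (Ex R D) \in label T x ->
  ~ (exists2 z, succ O T R x z & icon D \in label T z) ->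
  ~ blocked T x -> y \notin nodes T ->
  addressing L (add_node T x R y D) (fun z => if z == y
    then ((addr x).1, rcons (addr x).2 (label T x, icon (Ex R D))) else addr z).
Proof.
move=> w [h1 h2 h3 h4 h5 h6] sL xT hx nz nb yT.
have ne z : z \in nodes T -> (z == y) = false.
  by move=> zT; apply: contraNF yT => /eqP<-.
have new z : z \in nodes T ->
    addr z <> ((addr x).1, rcons (addr x).2 (label T x, icon (Ex R D))).
  move=> zT /(h6 _ _ _ _ _ _ zT)[x' [x'T ax xz Dz]]; apply: nz; exists z => //.
  exists R; last exact: rt_refl.
  suff <- : x' = x by [].
  by apply: h1 => //; rewrite ax; case: (addr x).
split=> /=.
- move=> u v; rewrite !in_fset1U; case: eqP => [->|_] /=; case: eqP => [->|_] //= uT vT.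
  + by move/esym/(new _ vT).
  + by move/(new _ uT).
  + exact: h1.
- by move=> z; rewrite in_fset1U; case: eqP => //= _ zT; apply: h2.
- move=> z; rewrite in_fset1U; case: eqP => //= _ zT; last exact: h3.
  rewrite map_rcons rcons_uniq h3 //= andbT; apply/negP => /(h5 _ _ xT)[x' anc sub].
  by apply: nb; exists x'.
- move=> z; rewrite in_fset1U; case: eqP => //= _ zT; last exact: h4.
  move=> e; rewrite mem_rcons in_cons => /orP[/eqP->|/h4]; last exact.
  by rewrite in_fsetM fpowersetE sL /= (fsubsetP sL).
- move=> z A; rewrite in_fset1U; case: eqP => [->|_] /= zT.
    rewrite map_rcons mem_rcons in_cons => /orP[/eqP->|/(h5 _ _ xT)[x' anc sA]].
      exists x; last by rewrite ne.
      split; first by move=> xy; rewrite -xy xT in yT.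
      by apply: t_step; exists R; rewrite in_fset1U eqxx.
    have x'T := ancestor_nodes w anc.
    exists x'; last by rewrite ne.
    split; first by move=> xy; rewrite -xy x'T in yT.
    apply: (t_trans _ _ _ x); first exact: (proj2 (ancestor_new x R y D anc)).
    by apply: t_step; exists R; rewrite in_fset1U eqxx.
  case/(h5 _ _ zT) => x' anc sA; exists x'; first exact: ancestor_new.
  by rewrite ne // (ancestor_nodes w anc).
- move=> z r s A P E; rewrite in_fset1U; case: eqP => [->|_] /= zT.
    case=> <- /rcons_inj[<- _ <- <-]; exists x.
    by rewrite ne // !in_fset1U eqxx xT orbT in_fset1 eqxx; split=> //; case: (addr x).
  case/(h6 _ _ _ _ _ _ zT) => x' [x'T ax xz Ez]; exists x'.
  by rewrite ne // !in_fset1U x'T xz !orbT; split.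
Qed.

Lemma addressing_reach L :
  (forall T, reach (init O) T -> forall x, label T x `<=` L) ->
  forall T, reach (init O) T -> exists addr, addressing L T addr.
Proof.
move=> HL T rT; suff [] : reach (init O) T /\ exists addr, addressing L T addr by [].
move: T rT; apply: reach_ind.
  by split; [exact: rt_refl|eexists; exact: addressing_init].
move=> T T' [rT [addr aT]] st; have w := tableau_wf_reach rT.
split; first exact: rt_trans rT (rt_step _ _ _ _ st).
case: (step_specP w st) => [g _|R D x y xT hx nz nb yT ->].
  by exists addr; apply: addressing_grows aT.
by eexists; apply: addressing_new aT _ xT hx nz nb yT => //; apply: HL.
Qed.

Definition weight (T : tableau) : nat :=
  \sum_(x <- nodes T) #|` label T x|.+1.

Lemma weight_step T T' : tableau_wf T -> step O T T' -> weight T < weight T'.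
Proof.
move=> w /(step_specP w)[[nE _ lS _] [x xT [i i' i0]]|R D x y xT _ _ _ yT ->].
  rewrite /weight nE !(big_fsetD1 x xT) /= -addSn; apply: leq_add.
    rewrite ltnS; apply: fproper_ltn_card; rewrite fproperEneq lS andbT.
    by apply: contraNneq i0 => ->.
  by apply: leq_sum => z _; rewrite ltnS; apply: fsubset_leq_card.
rewrite /weight /= big_fsetU1 //= eqxx cardfs1.
rewrite add2n ltnS ltnW // ltnS; apply: eq_leq; apply: eq_big_seq => z zT.
by case: eqP => // zy; rewrite -zy zT in yT.
Qed.

Lemma weight_bounded : exists N, forall T, reach (init O) T -> weight T <= N.
Proof.
have [L HL] := labels_finite.
have [B HB] := uniq_seqs_finite (fpowerset L `*` L)%fset.
pose X := (nodes (init O) `*` B)%fset.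
exists (#|` X| * #|` L|.+1) => T rT.
have [addr aT] := addressing_reach HL rT.
apply: (@leq_trans (\sum_(x <- nodes T) #|` L|.+1)).
  by apply: leq_sum => x _; rewrite ltnS; apply/fsubset_leq_card/HL.
rewrite big_const_seq count_predT iter_addn_0 mulnC leq_mul2r.
have <- : size [seq addr x | x <- nodes T] = size (nodes T) by rewrite size_map.
apply/orP; right; rewrite /=; apply: uniq_leq_size.
  by rewrite map_inj_in_uniq ?fset_uniq //; apply: addr_inj aT.
move=> _ /mapP[x xT ->]; rewrite in_fsetM (addr_root aT) //=; apply: HB.
  exact: map_uniq (addr_uniq aT xT).
exact: addr_sub aT _ xT.
Qed.

Lemma consistent_complete_clash_free : consistent O ->
  exists T, tableau_for O T /\ clash_free T.
Proof.
case=> I mI; have [N HN] := weight_bounded.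
suff [T [rT sT cT]] : exists T, [/\ reach (init O) T, satisfiable I T & complete O T].
  by exists T; split; [split|apply: satisfiable_clash_free sT].
have [n] := ubnP (N - weight (init O)).
move: (rt_refl _ (@step NC NR NI O) (init O)) (satisfiable_init mI).
move: {2 3 4}(init O) => T; elim: n T => // n IHn T rT sT le_n.
have [cT|/not_all_ex_not[T' /NNPP st]] := classic (complete O T); first by exists T.
have w := tableau_wf_reach rT.
have [T2 st2 sT2] := satisfiable_step mI w sT st.
have rT2 : reach (init O) T2 by apply: rt_trans rT (rt_step _ _ _ _ st2).
apply: (IHn T2) => //; rewrite ltnS in le_n; apply: leq_trans le_n.
have lt := weight_step w st2.
exact: ltn_sub2l (leq_trans lt (HN _ rT2)) lt.
Qed.

End Tableaux.

Theorem theorem2 (NC NR : choiceType) (NI : finType) (NI_nonempty : 0 < #|NI|)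
    (O : ontology NC NR NI) :
  consistent O <->
  exists T : tableau NC NR NI, tableau_for O T /\ clash_free T.
Proof.
split; first exact: consistent_complete_clash_free.
by case=> T [tT cf]; apply: complete_clash_free_consistent cf.
Qed.
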